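(* Let $e>0$, $\tau>0$ and $\bar h>0$. If $g\in\left(0,\dfrac{3e^2}{5\bar h}\right)$, then the 2-dimensional 9-velocity (D2Q9) lattice Boltzmann model for the shallow water equations with equilibrium distribution $$f_i^{eq}(h,\mathbf u)=\begin{cases}h-\dfrac{5gh^2}{6e^2}-\dfrac{2}{3e^2}h|\mathbf u|^2, & i=0,\\[2ex]\dfrac{gh^2}{6e^2}+\dfrac{1}{3e^2}h\,\boldsymbol\xi_i\cdot\mathbf u+\dfrac{1}{2e^4}h(\boldsymbol\xi_i\cdot\mathbf u)^2-\dfrac{1}{6e^2}h|\mathbf u|^2, & 1\le i\le 4,\\[2ex]\dfrac{gh^2}{24e^2}+\dfrac{1}{12e^2}h\,\boldsymbol\xi_i\cdot\mathbf u+\dfrac{1}{8e^4}h(\boldsymbol\xi_i\cdot\mathbf u)^2-\dfrac{1}{24e^2}h|\mathbf u|^2, & 5\le i\le 8,\end{cases}$$ is stable at the constant state $f_*=f^{eq}(\bar h,\mathbf 0)$, in the sense of the stability structure defined in the context (with $d=2$, $N=9$).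
   Context: **Discrete-velocity Boltzmann equation.** For velocities $\boldsymbol\xi_0,\dots,\boldsymbol\xi_{N-1}\in\mathbb R^d$, consider the system $$\frac{\partial f_i}{\partial t}+\boldsymbol\xi_i\cdot\nabla f_i=J_i(f),\qquad i=0,1,\dots,N-1,$$ for $f=(f_0,\dots,f_{N-1})^T$, with $J(f)=(J_0(f),\dots,J_{N-1}(f))^T$. Let $J_f(f)\in\mathbb R^{N\times N}$ denote the Jacobian matrix of $J$ with respect to $f$. **Stability structure (definition).** Let $f_*$ be a constant state with $J(f_* )=0$. The system is called stable at $f_*$ if there is an invertible matrix $P\in\mathbb R^{N\times N}$ such that $P^TP$ is diagonal, $P^TP=\mathrm{diag}(a_1,\dots,a_N)$, and $$P\,J_f(f_* )=-\mathrm{diag}(\lambda_1,\dots,\lambda_N)\,P$$ with $\lambda_i=0$ for $i\le d+1$ and $\lambda_i>0$ for $i>d+1$. **The D2Q9 model.** Here $d=2$, $N=9$, $e>0$ is the lattice speed, $g$ is the (reduced) gravity, $\tau>0$ is the relaxation time, $\boldsymbol\xi_0=(0,0)^T$, $\{\boldsymbol\xi_1,\dots,\boldsymbol\xi_4\}=\{(\pm e,0)^T,(0,\pm e)^T\}$ and $\{\boldsymbol\xi_5,\dots,\boldsymbol\xi_8\}=\{(\pm e,\pm e)^T\}$ (all four sign choices). For $f$ with $\sum_i f_i>0$, the water depth $h$ and velocity $\mathbf u\in\mathbb R^2$ are defined by $h=\sum_{i=0}^8 f_i$, $h\mathbf u=\sum_{i=0}^8\boldsymbol\xi_i f_i$.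 The collision term is of BGK type, $$J_i(f)=\frac{f_i^{eq}(h,\mathbf u)-f_i}{\tau},$$ where $h,\mathbf u$ are the functions of $f$ just given and $f^{eq}$ is the equilibrium distribution given in the claim. *)

(* Defs.v *)
From HB Require Import structures.
From mathcomp Require Import all_boot all_order all_algebra.
From mathcomp Require Import all_classical all_reals all_analysis.
Import Order.TTheory GRing.Theory Num.Theory numFieldNormedType.Exports.

Set Implicit Arguments.
Unset Strict Implicit.
Unset Printing Implicit Defensive.

Local Open Scope classical_set_scope.
Local Open Scope ring_scope.

(* The matrix (d J_i / d f_j)_(i, j), acting on column vectors. The library's
   'J is the transposed one, since it acts on row vectors: v *m 'J F x = 'D_v F x. *)
Definition jacobian_col (R : realType) (N : nat) (J : 'rV[R]_N -> 'rV[R]_N)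
    (f : 'rV[R]_N) : 'M[R]_N :=
  (jacobian J f)^T.

(* Stability structure at fs of a system of N equations in dimension d with
   collision term J. Indices start at 0, so that lambda_1, ..., lambda_{d+1}
   are the lam 0 i with i < d + 1. Differentiability ensures that the total
   operator 'd behind the Jacobian is a genuine derivative. *)
Definition stable_at (R : realType) (d N : nat) (J : 'rV[R]_N -> 'rV[R]_N)
    (fs : 'rV[R]_N) : Prop :=
  [/\ J fs = 0,
      differentiable J fs &
      exists (P : 'M[R]_N) (a lam : 'rV[R]_N),
        [/\ P \in unitmx,
            P^T *m P = diag_mx a,
            P *m jacobian_col J fs = - diag_mx lam *m P,
            (forall i : 'I_N, (i < d.+1)%N -> lam 0 i = 0) &
            (forall i : 'I_N, (d.+1 <= i)%N -> 0 < lam 0 i)]].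

(* Euclidean products are spelled out: `|u| is the sup norm on row vectors. *)
Definition dot (R : realType) (d : nat) (u v : 'rV[R]_d) : R :=
  \sum_(k < d) u 0 k * v 0 k.

Definition vec2 (R : realType) (x y : R) : 'rV[R]_2 :=
  \row_(k < 2) (if k == 0 then x else y).

(* The order inside each of the two groups of four velocities is left free. *)
Definition D2Q9_velocities (R : realType) (e : R) (xi : 'I_9 -> 'rV[R]_2)
    : Prop :=
  [/\ xi 0 = 0,
      xi @` [set i : 'I_9 | (1 <= i <= 4)%N] =
        [set vec2 e 0; vec2 (- e) 0; vec2 0 e; vec2 0 (- e)] &
      xi @` [set i : 'I_9 | (5 <= i <= 8)%N] =
        [set vec2 e e; vec2 e (- e); vec2 (- e) e; vec2 (- e) (- e)]].

Definition depth (R : realType) (N : nat) (f : 'rV[R]_N) : R :=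
  \sum_(i < N) f 0 i.

Definition velocity (R : realType) (d N : nat) (xi : 'I_N -> 'rV[R]_d)
    (f : 'rV[R]_N) : 'rV[R]_d :=
  (depth f)^-1 *: \sum_(i < N) f 0 i *: xi i.

Definition feq (R : realType) (e g : R) (xi : 'I_9 -> 'rV[R]_2)
    (h : R) (u : 'rV[R]_2) : 'rV[R]_9 :=
  \row_(i < 9)
    if i == 0 then
      h - 5 * g * h ^+ 2 / (6 * e ^+ 2) - 2 / (3 * e ^+ 2) * h * dot u u
    else if (i <= 4)%N then
      g * h ^+ 2 / (6 * e ^+ 2) + 1 / (3 * e ^+ 2) * h * dot (xi i) u
      + 1 / (2 * e ^+ 4) * h * dot (xi i) u ^+ 2
      - 1 / (6 * e ^+ 2) * h * dot u u
    else
      g * h ^+ 2 / (24 * e ^+ 2) + 1 / (12 * e ^+ 2) * h * dot (xi i) u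
      + 1 / (8 * e ^+ 4) * h * dot (xi i) u ^+ 2
      - 1 / (24 * e ^+ 2) * h * dot u u.

Definition collision (R : realType) (e g tau : R) (xi : 'I_9 -> 'rV[R]_2)
    (f : 'rV[R]_9) : 'rV[R]_9 :=
  tau^-1 *: (feq e g xi (depth f) (velocity xi f) - f).

(* Main.v *)
Require Import Defs.
From HB Require Import structures.
From mathcomp Require Import all_boot all_order all_algebra.
From mathcomp Require Import all_classical all_reals all_analysis.
From mathcomp Require Import ring lra.
Import Order.TTheory GRing.Theory Num.Theory numFieldNormedType.Exports.

(* At the rest state the velocity vanishes, so only the terms of f^eq that are
   at most linear in u survive differentiation, and
     d f^eq_i / d f_j = A_i (1 + xi_i . xi_j / (g hbar)),
   with weights A_i that are positive exactly because g < 3 e^2 / (5 hbar).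
   Since sum_i A_i = 1, sum_i A_i xi_i = 0 and
   sum_i A_i xi_i xi_i^T = g hbar Id, conjugating by diag(sqrt A_i) turns this
   matrix into V^T V, where V has three orthonormal rows. Completing V to an
   orthogonal matrix Q, the matrix P = Q diag(sqrt A_i)^-1 has the required
   properties, with eigenvalues 0 (three times) and 1 / tau (six times). *)

Set Implicit Arguments.
Unset Strict Implicit.
Unset Printing Implicit Defensive.

Local Open Scope ring_scope.

(** * Orthonormal completion and diagonalization of a weighted projection *)

(** Gram-Schmidt by induction on [m]: as long as [k < n], some non-zero row [w] is orthogonal to all
    rows of [V]; it is normalized and appended to [V]. *)
Lemma orthonormal_completion (R : rcfType) (m k n : nat) (V : 'M[R]_(k, n)) :
  (k + m = n)%N -> V *m V^T = 1%:M ->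
  exists U : 'M[R]_(m, n), U *m U^T = 1%:M /\ V *m U^T = 0.
Proof.
elim: m k V => [|m IHm] k V kmn VV.
  by exists 0; split; [rewrite [LHS]flatmx0 [RHS]flatmx0 | rewrite trmx0 mulmx0].
have /rowV0Pn[w /sub_kermxP wV w0] : kermx V^T != 0.
  rewrite -mxrank_eq0 mxrank_ker -lt0n subn_gt0.
  by rewrite (leq_ltn_trans (rank_leq_col _)) // -kmn addnS ltnS leq_addr.
have ww_gt0 : 0 < (w *m w^T) 0 0.
  have wwE : (w *m w^T) 0 0 = \sum_j w 0 j ^+ 2.
    by rewrite mxE; apply: eq_bigr => j _; rewrite mxE expr2.
  rewrite wwE lt0r sumr_ge0 ?andbT => [|j _]; last exact: sqr_ge0.
  apply: contra_neq w0 => /psumr_eq0P w0; apply/rowP => j; rewrite mxE.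
  by apply/eqP; rewrite -sqrf_eq0 w0 // => i _; exact: sqr_ge0.
pose r := (Num.sqrt ((w *m w^T) 0 0))^-1 *: w.
have rr : r *m r^T = 1%:M.
  apply/matrixP => i j; rewrite !ord1 /r linearZ /= -scalemxAl -scalemxAr scalerA.
  by rewrite mxE -invfM -expr2 sqr_sqrtr ?ltW // mulVf ?gt_eqF // mxE eqxx.
have rV : r *m V^T = 0 by rewrite /r -scalemxAl wV scaler0.
have Vr : V *m r^T = 0 by apply: trmx_inj; rewrite trmx_mul trmxK rV trmx0.
have [||U [UU VrU]] := IHm (k + 1)%N (col_mx V r).
- by rewrite -addnA add1n.
- by rewrite tr_col_mx mul_col_row VV rr rV Vr -scalar_mx_block.
move: VrU; rewrite mul_col_mx => /eqP; rewrite col_mx_eq0 => /andP[/eqP VU /eqP rU].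
have Ur : U *m r^T = 0 by apply: trmx_inj; rewrite trmx_mul trmxK rU trmx0.
(* [m.+1] is converted to [1 + m] so that [col_mx r U] has the required type. *)
change (exists W : 'M[R]_(1 + m, n), W *m W^T = 1%:M /\ V *m W^T = 0).
exists (col_mx r U); rewrite tr_col_mx mul_col_row UU rr rU Ur.
by rewrite mul_mx_row VU Vr row_mx0; split=> //; rewrite [RHS]scalar_mx_block.
Qed.

(** [V^T *m V] is the orthogonal projection onto the row space of [V]. An orthogonal [Q] whose first
    [k] rows are [V] diagonalizes it, and [Q *m invmx (diag_mx s)] absorbs the conjugation by
    [diag_mx s]. *)
Lemma weighted_projection_diagonalizable (R : rcfType) (k m : nat) (s : 'rV[R]_(k + m))
    (V : 'M[R]_(k, k + m)) (t : R) :
  (forall i, s 0 i != 0) -> V *m V^T = 1%:M ->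
  exists (P : 'M[R]_(k + m)) (a : 'rV_(k + m)),
    [/\ P \in unitmx, P^T *m P = diag_mx a &
      P *m (t *: (diag_mx s *m V^T *m V *m invmx (diag_mx s) - 1%:M)) =
        - diag_mx (row_mx 0 (const_mx t)) *m P].
Proof.
move=> s0 VV; have [U [UU VU]] := @orthonormal_completion R m k _ V erefl VV.
have UV : U *m V^T = 0 by apply: trmx_inj; rewrite trmx_mul trmxK VU trmx0.
pose Q : 'M[R]_(k + m) := col_mx V U.
have QQ : Q *m Q^T = 1%:M.
  by rewrite /Q tr_col_mx mul_col_row VV UU VU UV -scalar_mx_block.
have s_unit : diag_mx s \in unitmx.
  by rewrite unitmxE det_diag unitfE; apply/prodf_neq0 => i _; exact: s0.
have sV : invmx (diag_mx s) = diag_mx (\row_i (s 0 i)^-1).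
  apply: (can_inj (mulKmx s_unit)); rewrite mulmxV // mulmx_diag -diag_const_mx.
  by congr diag_mx; apply/rowP => i; rewrite !mxE divff.
exists (Q *m invmx (diag_mx s)), (\row_i (s 0 i)^-2); split.
- by rewrite unitmx_mul unitmx_inv s_unit (mulmx1_unit QQ).1.
- rewrite trmx_mul mulmxA -(mulmxA _ Q^T) (mulmx1C QQ) mulmx1 sV tr_diag_mx mulmx_diag.
  by congr diag_mx; apply/rowP => i; rewrite !mxE -invfM.
(* The inner factors [diag_mx s] cancel. What remains is [Q *m (V^T *m V - 1%:M)], whose blocks are
   [0] and [- U]. *)
rewrite -scalemxAr mulmxBr mulmx1 !mulmxA mulmxKV // -mulmxBl.
have -> : Q *m V^T *m V = col_mx V 0.
  by rewrite mul_col_mx VV UV mul_col_mx mul1mx mul0mx.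
rewrite /Q opp_col_mx add_col_mx subrr sub0r diag_mx_row linear0 diag_const_mx.
rewrite scalemxAl; congr (_ *m _).
rewrite mulNmx (mul_block_col _ _ _ _ V) !mul0mx !add0r mul_scalar_mx.
by rewrite scale_col_mx opp_col_mx scaler0 oppr0 scalerN.
Qed.

(** * Differentials of depth, velocity and the equilibrium components *)

Lemma is_diff_sum (R : numFieldType) (V W : normedModType R) (n : nat)
    (f df : 'I_n -> V -> W) (x : V) :
  (forall i, is_diff x (f i) (df i)) ->
  is_diff x (fun v => \sum_i f i v) (fun v => \sum_i df i v).
Proof.
move=> fdf.
have H : is_diff x (\sum_i f i) (\sum_i df i).
  apply: (big_ind2 (fun g dg => is_diff x g dg)) => [|g dg h dh Hg Hh|i _].
  - exact: is_diff_cst.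
  - exact: is_diffD.
  - exact: fdf.
have E (F : 'I_n -> V -> W) : (fun v => \sum_i F i v) = \sum_i F i.
  by apply/funext => v; rewrite fct_sumE.
by rewrite !E.
Qed.

Lemma is_diff_row (R : realFieldType) (V : normedModType R) (n : nat)
    (F dF : V -> 'rV[R]_n) (x : V) :
  (forall j, is_diff x (fun v => F v 0 j) (fun v => dF v 0 j)) ->
  is_diff x F dF.
Proof.
move=> FdF.
have E (G : V -> 'rV[R]_n) : G = fun v => \sum_j G v 0 j *: delta_mx 0 j.
  by apply/funext => v; rewrite [LHS]row_sum_delta.
rewrite (E F) (E dF); apply: is_diff_sum => j.
have [d e] := FdF j.
by apply: DiffDef; [exact: differentiableZl | rewrite diffZl// e].
Qed.

(** [is_diffM] restated for functions written pointwise, the form in which the components of [feq]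
    appear; [is_diff_scale] and [is_diff_add] serve the same purpose. *)
Lemma is_diff_mul (R : realFieldType) (V : normedModType R)
    (f g df dg : V -> R) (x : V) :
  is_diff x f df -> is_diff x g dg ->
  is_diff x (fun v => f v * g v) (fun v => f x * dg v + g x * df v).
Proof. exact: is_diffM. Qed.

Lemma is_diff_scale (R : realFieldType) (V : normedModType R)
    (f df : V -> R) (k : R) (x : V) :
  is_diff x f df -> is_diff x (fun v => k * f v) (fun v => k * df v).
Proof. exact: is_diffZ. Qed.

Lemma is_diff_weighted_sum (R : realFieldType) (N : nat) (c : 'I_N -> R) (x : 'rV[R]_N) :
  is_diff x (fun f : 'rV[R]_N => \sum_i f 0 i * c i) (fun v => \sum_i v 0 i * c i).
Proof.
apply: is_diff_sum => i.
have L : is_diff x (fun f : 'rV[R]_N => f 0 i) (fun f => f 0 i).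
  (* The coordinate is packed as a linear map; being continuous, it is its own differential. *)
  pose p : 'rV[R]_N -> R := fun f => f 0 i.
  pose lp := GRing.isLinear.Build R _ _ _ p
    (ltac:(by move=> a u v; rewrite /p !mxE)).
  pose pL : {linear 'rV[R]_N -> R} := HB.pack p lp.
  have cp : continuous pL by exact: coord_continuous.
  apply: DiffDef; first exact: (@linear_differentiable _ _ _ pL).
  exact: (@diff_lin _ _ _ pL).
have -> : (fun f : 'rV[R]_N => f 0 i * c i) = fun f => c i * f 0 i.
  by apply/funext => f; rewrite mulrC.
exact: is_diff_scale.
Qed.

Lemma is_diff_depth (R : realType) (N : nat) (x : 'rV[R]_N) :
  is_diff x (@depth R N) (@depth R N).
Proof.
have := is_diff_weighted_sum (fun=> 1) x.
by under eq_fun do under eq_bigr do rewrite mulr1.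
Qed.

Lemma velocityE (R : realType) (d N : nat) (xi : 'I_N -> 'rV[R]_d) (f : 'rV[R]_N) k :
  velocity xi f 0 k = (depth f)^-1 * \sum_i f 0 i * xi i 0 k.
Proof. by rewrite !mxE summxE; congr (_ * _); apply: eq_bigr => i _; rewrite mxE. Qed.

Lemma is_diff_velocity (R : realType) (d N : nat) (xi : 'I_N -> 'rV[R]_d) (x : 'rV[R]_N) :
  depth x != 0 -> \sum_i x 0 i *: xi i = 0 ->
  is_diff x (velocity xi) (fun v => (depth x)^-1 *: \sum_i v 0 i *: xi i).
Proof.
move=> x0 xxi; apply: is_diff_row => k.
have sumE (v : 'rV[R]_N) : (\sum_i v 0 i *: xi i) 0 k = \sum_i v 0 i * xi i 0 k.
  by rewrite summxE; apply: eq_bigr => i _; rewrite mxE.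
have -> : (fun v => velocity xi v 0 k) =
    (fun v => (depth v)^-1 * \sum_i v 0 i * xi i 0 k).
  by apply/funext => v; exact: velocityE.
(* The differential of the inverse depth stays abstract: the product rule multiplies it by the
   momentum of [x], which is zero. *)
have depth_inv : differentiable (fun v : 'rV[R]_N => (depth v)^-1) (nbhs x).
  by apply: differentiableV x0; have [] := is_diff_depth x.
apply: is_diff_eq (is_diff_mul (differentiableP depth_inv) (is_diff_weighted_sum _ x)) _.
apply/funext => v /=.
have xk : \sum_i x 0 i * xi i 0 k = 0 by rewrite -sumE xxi mxE.
by rewrite xk mul0r addr0 mxE sumE.
Qed.

Lemma is_diff_dot (R : realType) (V : normedModType R) (d : nat)
    (u w du dw : V -> 'rV[R]_d) (x : V) :
  is_diff x u du -> is_diff x w dw ->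
  is_diff x (fun v => dot (u v) (w v)) (fun v => dot (u x) (dw v) + dot (w x) (du v)).
Proof.
have coord (F dF : V -> 'rV[R]_d) k : is_diff x F dF ->
    is_diff x (fun v => F v 0 k) (fun v => dF v 0 k).
  (* A coordinate is a weighted sum with Kronecker weights. *)
  move=> FdF; have := is_diff_weighted_sum (fun i => (i == k)%:R) (F x).
  have -> : (fun f : 'rV[R]_d => \sum_i f 0 i * (i == k)%:R) = fun f => f 0 k.
    apply/funext => f; rewrite (bigD1 k) //= eqxx mulr1 big1 ?addr0 // => i /negPf ->.
    by rewrite mulr0.
  exact: is_diff_comp.
move=> udu wdw; apply: is_diff_eq.
  by apply: is_diff_sum => k; apply: is_diff_mul; apply: coord.
by apply/funext => v; rewrite /dot -big_split.
Qed.

(** This absorbs the unspecified order of the velocities: the cardinality condition forces [xi] to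
    be injective on [P], so its values there are a permutation of [t]. *)
Lemma sum_over_image (T : choiceType) (I : finType) (M : nmodType) (P : pred I)
    (xi : I -> T) (t : seq T) (F : T -> M) :
  uniq t -> #|P| = size t -> (xi @` [set i | P i] = [set` t])%classic ->
  \sum_(i | P i) F (xi i) = \sum_(x <- t) F x.
Proof.
move=> ut Pt im; pose s := [seq xi i | i <- enum P].
have st : {subset t <= s}.
  move=> x xt; have : ([set` t])%classic x by [].
  rewrite -im => -[i Pi <-]; by apply: map_f; rewrite mem_enum.
have sz : (size s <= size t)%N by rewrite size_map -cardE Pt.
have us := leq_size_uniq ut st sz.
have [_ ts] := uniq_min_size ut st sz.
have pst : perm_eq s t by apply: uniq_perm => // x; rewrite ts.
by rewrite -(perm_big _ pst) big_map big_enum.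
Qed.

Lemma is_diff_add (R : realFieldType) (V : normedModType R)
    (f g df dg : V -> R) (x : V) :
  is_diff x f df -> is_diff x g dg ->
  is_diff x (fun v => f v + g v) (fun v => df v + dg v).
Proof. exact: is_diffD. Qed.

Lemma dot0r (R : realType) (d : nat) (u : 'rV[R]_d) : dot u 0 = 0.
Proof. by rewrite /dot big1 // => k _; rewrite mxE mulr0. Qed.

Lemma dot0l (R : realType) (d : nat) (u : 'rV[R]_d) : dot 0 u = 0.
Proof. by rewrite /dot big1 // => k _; rewrite mxE mul0r. Qed.

Lemma dotZr (R : realType) (d : nat) (u v : 'rV[R]_d) (k : R) :
  dot u (k *: v) = k * dot u v.
Proof. by rewrite /dot mulr_sumr; apply: eq_bigr => i _; rewrite mxE mulrCA. Qed.

Lemma dot_sumr (R : realType) (d N : nat) (u : 'rV[R]_d) (xi : 'I_N -> 'rV[R]_d)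
    (v : 'rV[R]_N) :
  dot u (\sum_i v 0 i *: xi i) = \sum_i v 0 i * dot u (xi i).
Proof.
under [RHS]eq_bigr do rewrite -dotZr.
rewrite /dot exchange_big /=; apply: eq_bigr => k _.
by rewrite summxE mulr_sumr.
Qed.

(* The common shape of the components of [feq]; at a state of velocity [0] the
   quadratic terms in [u] do not contribute to the derivative. *)
Lemma is_diff_equilibrium (R : realType) (d N : nat) (xi : 'I_N -> 'rV[R]_d)
    (x : 'rV[R]_N) (w : 'rV[R]_d) (c1 c2 c3 c4 c5 : R) :
  depth x != 0 -> \sum_i x 0 i *: xi i = 0 ->
  is_diff x
    (fun f => c1 * depth f + c2 * depth f ^+ 2 + c3 * (depth f * dot w (velocity xi f))
       + c4 * (depth f * dot w (velocity xi f) ^+ 2)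
       + c5 * (depth f * dot (velocity xi f) (velocity xi f)))
    (fun v => (c1 + 2 * c2 * depth x) * depth v
       + c3 * dot w (\sum_i v 0 i *: xi i)).
Proof.
move=> x0 xxi; have du := is_diff_velocity x0 xxi; have dh := is_diff_depth x.
have ux : velocity xi x = 0 by rewrite /velocity xxi scaler0.
have dw : is_diff x (fun=> w) (fun=> 0) by exact: is_diff_cst.
have dwu := is_diff_dot dw du.
have duu := is_diff_dot du du.
have H := is_diff_add (is_diff_add (is_diff_add (is_diff_add
  (is_diff_scale c1 dh) (is_diff_scale c2 (is_diff_mul dh dh)))
  (is_diff_scale c3 (is_diff_mul dh dwu)))
  (is_diff_scale c4 (is_diff_mul dh (is_diff_mul dwu dwu))))
  (is_diff_scale c5 (is_diff_mul dh duu)).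
apply: (is_diff_eq H); apply/funext => v; rewrite ux !dot0r !dot0l dotZr.
by field.
Qed.

(** The differential is tested on the basis rows; the transposes pass between row vectors and the
    column convention of [jacobian_col]. *)
Lemma jacobian_colE (R : realType) (N : nat) (J : 'rV[R]_N -> 'rV[R]_N)
    (x : 'rV[R]_N) (B : 'M[R]_N) :
  is_diff x J (fun v => (B *m v^T)^T) -> jacobian_col J x = B.
Proof.
move=> [_ dJ]; apply/matrixP => i j; rewrite mxE /jacobian /lin1_mx mxE dJ mxE.
rewrite mxE (bigD1 j) //= big1 ?addr0 => [|k /negPf kj]; last first.
  by rewrite !mxE eqxx kj mulr0.
by rewrite !mxE !eqxx mulr1.
Qed.

(** * Weighted moments of the nine velocities *)

(** Coefficients that are constant on each class of velocities: rest, axis, diagonal. *)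
Definition weight (R : realType) (a b c : R) (i : 'I_9) : R :=
  if i == 0 then a else if (i <= 4)%N then b else c.

Definition axes (R : realType) (e : R) : seq 'rV[R]_2 :=
  [:: vec2 e 0; vec2 (- e) 0; vec2 0 e; vec2 0 (- e)].

Definition diagonals (R : realType) (e : R) : seq 'rV[R]_2 :=
  [:: vec2 e e; vec2 e (- e); vec2 (- e) e; vec2 (- e) (- e)].

Lemma vec2_eq (R : realType) (x y x' y' : R) :
  (vec2 x y == vec2 x' y') = (x == x') && (y == y').
Proof.
apply/eqP/andP => [E|[/eqP -> /eqP -> //]].
split; apply/eqP.
  by have := congr1 (fun v : 'rV_2 => v 0 0) E; rewrite !mxE.
by have := congr1 (fun v : 'rV_2 => v 0 1) E; rewrite !mxE.
Qed.

Lemma sum_weight (R : realType) (e : R) (xi : 'I_9 -> 'rV[R]_2) (a b c : R)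
    (F : 'rV[R]_2 -> R) : 0 < e -> D2Q9_velocities e xi ->
  \sum_i weight a b c i * F (xi i) =
    a * F 0 + b * (\sum_(x <- axes e) F x) + c * (\sum_(x <- diagonals e) F x).
Proof.
move=> e0 [xi0 xi1 xi2].
have eN : (e == - e) = false by apply/negbTE; rewrite -subr_eq0; apply/eqP; lra.
have Ne : (- e == e) = false by rewrite eq_sym.
have e_neq0 : (e == 0) = false by rewrite gt_eqF.
have zero_neq : (0 == e) = false by rewrite lt_eqF.
have u1 : uniq (axes e).
  by rewrite /= !inE !vec2_eq !eqr_oppLR ?oppr0 ?eqxx ?eN ?Ne ?e_neq0 ?zero_neq.
have u2 : uniq (diagonals e).
  by rewrite /= !inE !vec2_eq ?eqxx ?eN ?Ne.
have c1 : #|[pred i : 'I_9 | (1 <= i <= 4)%N]| = size (axes e).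
  by rewrite -sum1_card big_mkcond /= !big_ord_recl big_ord0.
have c2 : #|[pred i : 'I_9 | (5 <= i <= 8)%N]| = size (diagonals e).
  by rewrite -sum1_card big_mkcond /= !big_ord_recl big_ord0.
rewrite -(sum_over_image (xi := xi) F u1 c1); last first.
  rewrite xi1; apply/seteqP; split => x /=; rewrite !inE.
    by move=> [[[]|]|] ->; rewrite eqxx ?orbT.
  by move=> /or4P[] /eqP ->; tauto.
rewrite -(sum_over_image (xi := xi) F u2 c2); last first.
  rewrite xi2; apply/seteqP; split => x /=; rewrite !inE.
    by move=> [[[]|]|] ->; rewrite eqxx ?orbT.
  by move=> /or4P[] /eqP ->; tauto.
rewrite (bigD1 0) //= xi0 -addrA; congr (_ + _).
rewrite (bigID (fun i : 'I_9 => (i <= 4)%N)) /= !mulr_sumr.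
congr (_ + _); apply: eq_big => i.
- by rewrite lt0n.
- by rewrite /weight => /andP[/negPf -> ->].
(* The bound [i <= 8] holds for every [i : 'I_9], so the last class consists of all indices above
   4. *)
- rewrite -ltnNge -[LHS]andbC andbC -[(i <= 8)%N]ltnS ltn_ord andbT.
  by case: eqP => // ->.
- by rewrite /weight => /andP[/negPf -> /negPf ->].
Qed.

Lemma sum_weight_moment0 (R : realType) (e : R) (xi : 'I_9 -> 'rV[R]_2) (a b c : R) :
  0 < e -> D2Q9_velocities e xi ->
  \sum_i weight a b c i = a + 4 * b + 4 * c.
Proof.
move=> e0 hxi; have := sum_weight a b c (fun=> 1) e0 hxi.
under eq_bigr do rewrite mulr1.
by move=> ->; rewrite /axes /diagonals !big_cons !big_nil; ring.
Qed.

Lemma sum_weight_moment1 (R : realType) (e : R) (xi : 'I_9 -> 'rV[R]_2) (a b c : R) k :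
  0 < e -> D2Q9_velocities e xi ->
  \sum_i weight a b c i * xi i 0 k = 0.
Proof.
move=> e0 hxi; rewrite (sum_weight a b c (fun x => x 0 k) e0 hxi).
by rewrite /axes /diagonals !big_cons !big_nil !mxE; case: (k == 0); ring.
Qed.

(** Isotropy of the lattice: mixed products cancel by sign symmetry, while each direction is met by
    two axis and four diagonal velocities. *)
Lemma sum_weight_moment2 (R : realType) (e : R) (xi : 'I_9 -> 'rV[R]_2) (a b c : R) k l :
  0 < e -> D2Q9_velocities e xi ->
  \sum_i weight a b c i * (xi i 0 k * xi i 0 l) =
    (2 * b + 4 * c) * e ^+ 2 * (k == l)%:R.
Proof.
move=> e0 hxi; rewrite (sum_weight a b c (fun x => x 0 k * x 0 l) e0 hxi).
rewrite /axes /diagonals !big_cons !big_nil !mxE.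
by case: k l => [[|[|//]] hk] [[|[|//]] hl] /=; ring.
Qed.

(** * Diagonalization of the linearized collision term *)

(** The Jacobian of the equilibrium at rest, with [theta] standing for [g * h]. *)
Definition feq_jacobian (R : realType) (A : 'I_9 -> R) (theta : R)
    (xi : 'I_9 -> 'rV[R]_2) : 'M[R]_9 :=
  \matrix_(i, j) (A i * (1 + theta^-1 * dot (xi i) (xi j))).

(** The two equations on the weights A_i normalize the row of sqrt(A_i) and make the two rows of
    sqrt(A_i / theta) xi_i orthonormal; the vanishing first moment makes the former orthogonal to
    the latter. *)
Lemma stable_BGK_jacobian (R : realType) (e tau theta a b c : R)
    (xi : 'I_9 -> 'rV[R]_2) :
  0 < e -> D2Q9_velocities e xi -> 0 < theta -> 0 < a -> 0 < b -> 0 < c ->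
  a + 4 * b + 4 * c = 1 -> (2 * b + 4 * c) * e ^+ 2 = theta ->
  exists (P : 'M[R]_9) (d : 'rV[R]_9),
    [/\ P \in unitmx, P^T *m P = diag_mx d &
      P *m (tau^-1 *: (feq_jacobian (weight a b c) theta xi - 1%:M)) =
       - diag_mx (row_mx (0 : 'rV_3) (const_mx tau^-1 : 'rV_6)) *m P].
Proof.
move=> e0 hxi th0 a0 b0 c0 m0 m2.
have A0 i : 0 < weight a b c i by rewrite /weight; case: ifP => //; case: ifP.
pose s : 'rV[R]_9 := \row_i Num.sqrt (weight a b c i).
have s0 i : s 0 i != 0 by rewrite mxE gt_eqF // sqrtr_gt0.
have ss i : s 0 i * s 0 i = weight a b c i by rewrite mxE -expr2 sqr_sqrtr // ltW.
pose r := (Num.sqrt theta)^-1.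
have rr : r * r = theta^-1 by rewrite -invfM -expr2 sqr_sqrtr // ltW.
pose V1 : 'M[R]_(2, 9) := \matrix_(k, i) (r * (s 0 i * xi i 0 k)).
pose V : 'M[R]_(1 + 2, 9) := col_mx s V1.
have VV : V *m V^T = 1%:M.
  rewrite /V tr_col_mx mul_col_row [RHS]scalar_mx_block.
  have s1 : s *m V1^T = 0.
    apply/matrixP => i k; rewrite ord1 [LHS]mxE [RHS]mxE.
    transitivity (r * \sum_j weight a b c j * xi j 0 k).
      rewrite mulr_sumr; apply: eq_bigr => j _.
      by rewrite [V1^T _ _]mxE [V1 _ _]mxE -ss; ring.
    by rewrite (sum_weight_moment1 a b c k e0 hxi) mulr0.
  congr block_mx => //.
  - apply/matrixP => i k; rewrite !ord1 [LHS]mxE [RHS]mxE eqxx -m0.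
    rewrite -(sum_weight_moment0 a b c e0 hxi).
    by apply: eq_bigr => j _; rewrite [s^T _ _]mxE ss.
  - by apply: trmx_inj; rewrite trmx_mul trmxK s1 trmx0.
  apply/matrixP => k l; rewrite [LHS]mxE [RHS]mxE.
  transitivity (theta^-1 * \sum_i weight a b c i * (xi i 0 k * xi i 0 l)).
    rewrite mulr_sumr; apply: eq_bigr => j _.
    by rewrite [V1^T _ _]mxE ![V1 _ _]mxE -ss -rr; ring.
  by rewrite (sum_weight_moment2 a b c k l e0 hxi) m2 mulrA mulVf ?mul1r // gt_eqF.
(* Here [1 + 2] and [3 + 6] compute to 3 and 9: three conserved moments and six relaxing modes. *)
have [P [d [Pu PP PJ]]] := @weighted_projection_diagonalizable R 3 6 s V tau^-1 s0 VV.
exists P, d; split=> //; rewrite -PJ; congr (_ *m (_ *: (_ - _))).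
have s_unit : diag_mx s \in unitmx.
  by rewrite unitmxE det_diag unitfE; apply/prodf_neq0 => i _; exact: s0.
(* Multiplying by [diag_mx s] on the right clears the inverse and leaves an entrywise identity. *)
apply: (can_inj (mulmxK s_unit)); rewrite mulmxKV // -mulmxA.
rewrite [V^T](@tr_col_mx _ 1 2) (@mul_row_col _ _ 1 2) mul_mx_diag mul_diag_mx.
apply/matrixP => i j; rewrite [LHS]mxE [feq_jacobian _ _ _ _ _]mxE -ss.
rewrite [RHS]mxE [X in _ = _ * X]mxE.
have -> : (s^T *m s) i j = s 0 i * s 0 j by rewrite mxE big_ord1 mxE.
have -> : (V1^T *m V1) i j = theta^-1 * (s 0 i * s 0 j * dot (xi i) (xi j)).
  rewrite [LHS]mxE /dot -rr !mulr_sumr; apply: eq_bigr => k _.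
  by rewrite [V1^T _ _]mxE ![V1 _ _]mxE; ring.
by ring.
Qed.

(** * The equilibrium at rest and the derivative of the collision term there *)

Lemma feq_rest (R : realType) (e g h : R) (xi : 'I_9 -> 'rV[R]_2) (i : 'I_9) :
  feq e g xi h 0 0 i = weight (h - 5 * g * h ^+ 2 / (6 * e ^+ 2))
    (g * h ^+ 2 / (6 * e ^+ 2)) (g * h ^+ 2 / (24 * e ^+ 2)) i.
Proof. by rewrite mxE !dot0r /weight; case: ifP => _; [ring | case: ifP => _; ring]. Qed.

(** All components take the shape handled by [is_diff_equilibrium], so the three cases of [feq] are
    differentiated at once. *)
Lemma feqE (R : realType) (e g : R) (xi : 'I_9 -> 'rV[R]_2) (h : R) (u : 'rV[R]_2) i :
  feq e g xi h u 0 i =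
    weight 1 0 0 i * h
    + weight (- (5 * g / (6 * e ^+ 2))) (g / (6 * e ^+ 2)) (g / (24 * e ^+ 2)) i * h ^+ 2
    + weight 0 (1 / (3 * e ^+ 2)) (1 / (12 * e ^+ 2)) i * (h * dot (xi i) u)
    + weight 0 (1 / (2 * e ^+ 4)) (1 / (8 * e ^+ 4)) i * (h * dot (xi i) u ^+ 2)
    + weight (- (2 / (3 * e ^+ 2))) (- (1 / (6 * e ^+ 2))) (- (1 / (24 * e ^+ 2))) i
      * (h * dot u u).
Proof. by rewrite mxE /weight; case: ifP => _; [ring | case: ifP => _; ring]. Qed.

Lemma depth_feq_rest (R : realType) (e g h : R) (xi : 'I_9 -> 'rV[R]_2) :
  0 < e -> D2Q9_velocities e xi ->
  depth (feq e g xi h 0) = h.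
Proof.
move=> e0 hxi; rewrite /depth; under eq_bigr do rewrite feq_rest.
rewrite (sum_weight_moment0 _ _ _ e0 hxi); field.
by rewrite gt_eqF.
Qed.

Lemma momentum_feq_rest (R : realType) (e g h : R) (xi : 'I_9 -> 'rV[R]_2) :
  0 < e -> D2Q9_velocities e xi ->
  \sum_i feq e g xi h 0 0 i *: xi i = 0.
Proof.
move=> e0 hxi; apply/rowP => k; rewrite summxE [RHS]mxE.
rewrite -[RHS](sum_weight_moment1 (h - 5 * g * h ^+ 2 / (6 * e ^+ 2))
    (g * h ^+ 2 / (6 * e ^+ 2)) (g * h ^+ 2 / (24 * e ^+ 2)) k e0 hxi).
by apply: eq_bigr => i _; rewrite mxE feq_rest.
Qed.

Lemma collision_feq_rest (R : realType) (e g h tau : R) (xi : 'I_9 -> 'rV[R]_2) :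
  0 < e -> D2Q9_velocities e xi ->
  collision e g tau xi (feq e g xi h 0) = 0.
Proof.
move=> e0 hxi; rewrite /collision depth_feq_rest // /velocity momentum_feq_rest //.
by rewrite scaler0 subrr scaler0.
Qed.

Lemma is_diff_collision_rest (R : realType) (e g h tau : R) (xi : 'I_9 -> 'rV[R]_2) :
  0 < e -> D2Q9_velocities e xi -> 0 < h -> 0 < g ->
  is_diff (feq e g xi h 0) (collision e g tau xi)
    (fun v => (tau^-1 *: (feq_jacobian (weight (1 - 5 * (g * h) / (3 * e ^+ 2))
      (g * h / (3 * e ^+ 2)) (g * h / (12 * e ^+ 2))) (g * h) xi - 1%:M) *m v^T)^T).
Proof.
move=> e0 hxi h0 g0; set x := feq e g xi h 0; set D := feq_jacobian _ _ _.
have xh : depth x = h := depth_feq_rest g h e0 hxi.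
have x0 : depth x != 0 by rewrite xh gt_eqF.
have dF : is_diff x (fun f => feq e g xi (depth f) (velocity xi f))
    (fun v => (D *m v^T)^T).
  apply: is_diff_row => i.
  have DE (v : 'rV[R]_9) : (D *m v^T)^T 0 i =
      weight (1 - 5 * (g * h) / (3 * e ^+ 2)) (g * h / (3 * e ^+ 2))
        (g * h / (12 * e ^+ 2)) i *
      (depth v + (g * h)^-1 * dot (xi i) (\sum_j v 0 j *: xi j)).
    rewrite !mxE dot_sumr /depth mulr_sumr -big_split mulr_sumr /=.
    by apply: eq_bigr => j _; rewrite !mxE; ring.
  have -> : (fun v => (D *m v^T)^T 0 i) = _ := funext DE.
  have FE (f : 'rV[R]_9) := feqE e g xi (depth f) (velocity xi f) i.
  have -> : (fun f => feq e g xi (depth f) (velocity xi f) 0 i) = _ := funext FE.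
  apply: (is_diff_eq (is_diff_equilibrium _ _ _ _ _ _ x0 (momentum_feq_rest g h e0 hxi))).
  (* In each class [c1 + 2 * c2 * h] is the weight. For moving velocities [c3] is the weight divided
     by [g * h]; for [i = 0] the linear term vanishes on both sides because [xi 0 = 0]. *)
  apply/funext => v; rewrite xh /weight; case: eqP => [->|_].
    by have [-> _ _] := hxi; rewrite !dot0l; field; rewrite !gt_eqF.
  by case: ifP => _; field; rewrite !gt_eqF.
have H := is_diffZ tau^-1 (is_diffB dF (is_diff_id x)).
apply: (is_diff_eq H); apply/funext => v.
rewrite -[LHS]/(tau^-1 *: ((D *m v^T)^T - v)) -scalemxAl mulmxBl mul1mx.
by rewrite [RHS]linearZ [X in _ = _ *: X]linearB /= trmxK.
Qed.

Theorem proposition2 (R : realType) (e tau hbar g : R) (xi : 'I_9 -> 'rV[R]_2)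
    (he : 0 < e) (htau : 0 < tau) (hhbar : 0 < hbar)
    (hg : 0 < g < 3 * e ^+ 2 / (5 * hbar))
    (hxi : D2Q9_velocities e xi) :
  stable_at 2 (collision e g tau xi) (feq e g xi hbar 0).
Proof.
have [g0 gh] := andP hg.
have th0 : 0 < g * hbar by exact: mulr_gt0.
have e2 : 0 < 3 * e ^+ 2 by rewrite mulr_gt0 // exprn_gt0.
have dJ := is_diff_collision_rest tau he hxi hhbar g0.
split; [exact: collision_feq_rest | by have [] := dJ |].
rewrite (jacobian_colE dJ).
have [||||||P [a [Pu PP PJ]]] := @stable_BGK_jacobian R e tau (g * hbar)
  (1 - 5 * (g * hbar) / (3 * e ^+ 2)) (g * hbar / (3 * e ^+ 2))
  (g * hbar / (12 * e ^+ 2)) xi he hxi.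
- by [].
(* Positivity of the rest weight is the upper bound on [g]. *)
- rewrite subr_gt0 ltr_pdivrMr // mul1r mulrCA.
  by move: gh; rewrite ltr_pdivlMr ?mulr_gt0.
- exact: divr_gt0.
- by rewrite divr_gt0 // mulr_gt0 // exprn_gt0.
- by field; rewrite gt_eqF.
- by field; rewrite gt_eqF.
exists P, a, (row_mx (0 : 'rV_3) (const_mx tau^-1 : 'rV_6)); split=> // i.
(* The zero block of [row_mx] has length 3, which is [d.+1] for [d = 2]. *)
- by move=> i3; rewrite mxE; case: splitP => [j _|j ij]; rewrite ?mxE // ij in i3 *.
- move=> i3; rewrite mxE; case: splitP => [j ij|j _]; last by rewrite mxE invr_gt0.
  by rewrite ij leqNgt ltn_ord in i3.
Qed.
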